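(* Let $A_n$ be a commutative, associative, unital real algebra of finite dimension $n$. If $A_n$ contains at least one element whose characteristic polynomial is minimal (i.e. is also its minimal polynomial), then $A_n$ is polynomial.
   Context: The characteristic polynomial of an element $d\in A_n$ is the (degree $n$) characteristic polynomial of the $\mathbb R$-linear map $w\mapsto dw$ on $A_n$; the minimal polynomial of $d$ is the monic real polynomial of least degree annihilating $d$. (Characteristic polynomials are considered up to the sign normalization making them monic.) The algebra $A_n$ is called polynomial if it contains an element $v$ such that $\{v^0,v,\ldots,v^{n-1}\}$ is a basis, i.e. if it is isomorphic to $\mathbb R[X]/(P)$ for some $P\in\mathbb R[X]$ of degree $n$. *)

(* Defs.v *)
From HB Require Import structures.
From mathcomp Require Import all_boot all_order all_algebra all_field.

Set Implicit Arguments.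
Unset Strict Implicit.
Unset Printing Implicit Defensive.

Import GRing.Theory.

Local Open Scope ring_scope.

Section Defs.

Variables (K : fieldType) (A : falgType K).

(* [amull d] is w |-> d * w.  [mxof] uses the row-vector convention, so this  *)
(* is the transpose of the textbook matrix of [amull d] in the basis [vbasis],*)
(* which has the same characteristic polynomial; [char_poly] is \det (X - M), *)
(* hence monic of degree \dim {:A}.                                           *)
Definition elt_char_poly (d : A) : {poly K} :=
  char_poly (passmx.mxof (vbasis {:A}) (vbasis {:A}) (amull d)).

(* [horner_alg d q] is the value q(d) in A.  Monic polynomials are nonzero,   *)
(* so comparing sizes is comparing degrees.                                   *)
Definition is_elt_min_poly (d : A) (p : {poly K}) : Prop :=
  [/\ p \is monic,
      horner_alg d p = 0
    & forall q : {poly K},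
        q \is monic -> horner_alg d q = 0 -> (size p <= size q)%N].

Definition polynomial_alg : Prop :=
  exists v : A, basis_of {:A} [tuple v ^+ i | i < \dim {:A}].

End Defs.

Arguments polynomial_alg {K} A.

(* Main.v *)
Require Import Defs.
From mathcomp Require Import all_boot all_order all_algebra all_field.
From mathcomp Require Import reals.

(** The characteristic polynomial of an element [d] of an algebra of dimension
    [n] has degree exactly [n].  When it is minimal among the monic polynomials
    annihilating [d], no nonzero polynomial of degree less than [n] annihilates
    [d] ([annihilator_small_eq0]).  The coefficients of a linear relation
    between [1, d, ..., d ^+ n.-1] form such a polynomial, so these [n] powers
    are free ([free_powers]) and hence, by dimension, a basis: [d] itself
    generates the algebra. *)

Local Open Scope ring_scope.

Import GRing.Theory.

Lemma size_elt_char_poly (K : fieldType) (A : falgType K) (d : A) :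
  size (elt_char_poly d) = (\dim {:A}).+1.
Proof. by rewrite /elt_char_poly size_char_poly. Qed.

(** Dividing by the leading coefficient extends the minimality of [p] from
    monic annihilators to all nonzero ones. *)
Lemma annihilator_small_eq0 (K : fieldType) (A : falgType K) (d : A)
    (p q : {poly K}) :
  is_elt_min_poly d p -> horner_alg d q = 0 -> (size q < size p)%N -> q = 0.
Proof.
case=> _ _ p_min qd0 ltqp; apply/eqP/negPn/negP=> q_neq0.
have lq_neq0 : lead_coef q != 0 by rewrite lead_coef_eq0.
have monq : (lead_coef q)^-1 *: q \is monic.
  by rewrite monicE lead_coefZ mulVf.
have := p_min _ monq; rewrite -mul_polyC rmorphM /= qd0 mulr0 mul_polyC size_scale ?invr_eq0 //.
by move=> /(_ erefl); rewrite leqNgt ltqp.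
Qed.

Lemma free_powers (K : fieldType) (A : falgType K) (d : A) (p : {poly K})
    (n : nat) :
  is_elt_min_poly d p -> (n < size p)%N -> free [tuple d ^+ i | i < n].
Proof.
move=> p_min ltnp; apply/freeP=> k k_rel i.
pose q : {poly K} := \sum_(j < n) k j *: 'X^j.
(* [\poly] takes coefficients indexed by [nat], while [k] is indexed by 'I_n. *)
have q_poly : q = \poly_(j < n) (if insub j is Some j' then k j' else 0).
  by rewrite poly_def; apply: eq_bigr => j _; rewrite valK.
have q0 : q = 0.
  apply: (annihilator_small_eq0 _ _ _ _ q p_min); last first.
    by rewrite q_poly; apply: leq_ltn_trans ltnp; apply: size_poly.
  rewrite -[RHS]k_rel linear_sum; apply: eq_bigr => j _.
  rewrite -mul_polyC rmorphM rmorphXn /= horner_algC horner_algX.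
  by rewrite mulr_algl (nth_mktuple _ _ j).
have := congr1 (coefp i) q0.
by rewrite /= q_poly coef_poly ltn_ord valK coef0.
Qed.

Theorem mainTheorem7 (R : realType) (A : falgType R)
    (A_comm : commutative (@GRing.mul A)) :
  (exists d : A, is_elt_min_poly d (elt_char_poly d)) ->
  polynomial_alg A.
Proof.
case=> d d_min; exists d.
rewrite basisEfree subvf size_tuple leqnn !andbT.
by apply: free_powers d_min _; rewrite size_elt_char_poly.
Qed.
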